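(* Let $\theta>0$, let $N\ge1$ be an integer and $k\in\mathbb{N}$. The following identity holds: $$\sum_\lambda F_{N,k}(\lambda)\,e^{-N\theta}\frac{\theta^{|\lambda|}}{|\lambda|!}\,s_\lambda(1^N)\,f^\lambda=\theta^k\;{}_3F_1\left(\begin{matrix}-k,-k,1-N\\ 2\end{matrix};-\frac1\theta\right),$$ where the sum is over all integer partitions $\lambda$ (the terms with $\lambda$ having more than $N$ parts being $0$, since then $s_\lambda(1^N)=0$).
   Context: Conventions: $\mathbb{N}=\{0,1,2,\dots\}$; an empty product is $1$. For an integer partition $\lambda$, $|\lambda|=\sum_i\lambda_i$; $s_\lambda(x_1,\dots,x_N)$ is the Schur polynomial in $N$ variables, $s_\lambda(1^N)=s_\lambda(1,\dots,1)$ ($N$ ones), and $f^\lambda$ is the number of standard Young tableaux of shape $\lambda$. For $\lambda$ with at most $N$ parts (padded by zeros to length $N$), $$F_{N,k}(\lambda)=\frac1N\sum_{i=1}^N(\lambda_i+N-i)(\lambda_i+N-i-1)\cdots(\lambda_i+N-i-k+1).$$ Hypergeometric notation: $(a)_i=a(a+1)\cdots(a+i-1)$ and ${}_3F_1\left(\begin{matrix}a,b,c\\ d\end{matrix};z\right)=\sum_{i\ge0}\frac{(a)_i(b)_i(c)_i}{(d)_i}\frac{z^i}{i!}$, which terminates if one of $a,b,c$ is a nonpositive integer. *)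

(* Defs.v *)
From mathcomp Require mpoly.
From mathcomp Require Import all_boot all_order all_algebra.

Set Implicit Arguments.
Unset Strict Implicit.
Unset Printing Implicit Defensive.

Import Order.TTheory GRing.Theory Num.Theory.

(* A partition is the sequence of its nonzero parts, so that nth 0 l i is the
   i-th part of l padded with zeros (indices start at 0), size l is the number
   of parts and sumn l is |l|. *)
Definition is_intpart (l : seq nat) : bool := sorted geq l && (0 \notin l).

(* The box (i, j), j < l_i, of the Young diagram of l: i = tag b, j = tagged b. *)
Notation box l := {i : 'I_(size l) & 'I_(nth 0 l i)}.

Definition semistandard (l : seq nat) (n : nat) (T : {ffun box l -> 'I_n}) :=
  [forall b : box l, forall c : box l,
    ((tag b == tag c) && (tagged b <= tagged c) ==> (T b <= T c)) &&
    ((tagged b == tagged c :> nat) && (tag b < tag c) ==> (T b < T c))].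

(* The entries 1, ..., |l| are encoded as 0, ..., |l| - 1; as there are |l|
   boxes, injectivity says that each entry occurs exactly once, and it makes
   the rows strictly increasing. *)
Definition standard (l : seq nat) (T : {ffun box l -> 'I_(sumn l)}) :=
  semistandard T && injectiveb T.

Definition num_syt (l : seq nat) : nat :=
  #|[set T : {ffun box l -> 'I_(sumn l)} | standard T]|.

Section Schur.
(* mpoly's notations clash with those of MathComp-Analysis, which is therefore
   only imported after this section. *)
Import mpoly.
Local Open Scope ring_scope.

Definition schur (R : comNzRingType) (N : nat) (l : seq nat) : {mpoly R[N]} :=
  \sum_(T : {ffun box l -> 'I_N} | semistandard T) \prod_(b : box l) 'X_(T b).

Definition schur1 (R : comNzRingType) (N : nat) (l : seq nat) : R :=
  (schur R N l).@[fun=> 1].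

End Schur.

From mathcomp Require Import all_classical all_reals all_analysis.
Import numFieldNormedType.Exports.

Local Open Scope ring_scope.

(* The index i : 'I_N starts at 0, whence N - i.+1, and n ^_ k is the product
   n (n - 1) ... (n - k + 1), which is 0 when n < k. *)
Definition F_moment (R : realType) (N k : nat) (l : seq nat) : R :=
  N%:R^-1 * \sum_(i < N) ((nth 0%N l i + (N - i.+1)) ^_ k)%:R.

Definition pochhammer (R : realType) (a : R) (i : nat) : R :=
  \prod_(j < i) (a + j%:R).

Definition hypergeom31 (R : realType) (a b c d z : R) : R :=
  limn (series (fun i : nat =>
    pochhammer a i * pochhammer b i * pochhammer c i / pochhammer d i *
    (z ^+ i / i`!%:R))).

(* Main.v *)
(* Put L_i = lambda_i + N - i and let E_i be the shift L_i -> L_i + 1. Then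
   s_lambda(1^N) is D(L) = det [C(L_i, N - j)], which is alternating in L, and
   f^lambda counts the walks by unit steps from the staircase delta to L that
   stay in the chamber L_1 > ... > L_N. Alternating functions g vanish on the
   walls of the chamber, so that sum_(|lambda| = n) f^lambda g(L) is
   (U^n g)(delta), with U = E_1 + ... + E_N.

   Let M_(k,s) = sum_i L_i^_k E_i^s D, with falling factorials x^_k; thus
   M_(k,0) is N F_(N,k)(lambda) s_lambda(1^N). As U D = N D, the product rule
   gives U M_(k,s) = N M_(k,s) + k M_(k-1,s+1), hence a binomial formula for
   U^n M_(k,0). The Newton expansion of x^_k C(x+s, j) yields
   M_(k,s)(delta) = C(k+s, k) k! C(N, k+1). Summing over n against
   theta^n / n! cancels e^(-N theta) and leaves
   1/N sum_(r <= k) k! C(k, r) C(N, k-r+1) theta^r / r!,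
   which is theta^k times the 3F1 read backwards. *)
Require Import Defs.
From mathcomp Require mpoly.
From mathcomp Require Import all_boot all_order perm all_algebra ring zify.
From mathcomp Require Import all_classical all_reals all_analysis.

Set Implicit Arguments.
Unset Strict Implicit.
Unset Printing Implicit Defensive.

Import Order.TTheory GRing.Theory Num.Theory.
Import numFieldNormedType.Exports.
Local Open Scope classical_set_scope.
Local Open Scope ring_scope.

(** * Tableaux and their restriction to the smaller entries *)

Section Tableaux.
Local Open Scope nat_scope.

Lemma semistandardP l n (T : {ffun box l -> 'I_n}) :
  reflect (forall b c : box l,
     (tag b = tag c -> tagged b <= tagged c -> T b <= T c) /\
     (tagged b = tagged c :> nat -> tag b < tag c -> T b < T c))
   (semistandard T).
Proof.
apply: (iffP forallP) => [sT b c | sT b].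
  have /forallP/(_ c)/andP[row col] := sT b.
  split=> [/eqP e le_bc|/eqP e lt_bc].
    by move: row; rewrite e le_bc; apply.
  by move: col; rewrite e lt_bc; apply.
apply/forallP => c; have [row col] := sT b c.
by apply/andP; split; apply/implyP => /andP[/eqP]; [apply: row|apply: col].
Qed.

Lemma box_inj l (b c : box l) :
  tag b = tag c :> nat -> tagged b = tagged c :> nat -> b = c.
Proof.
case: b c => [i j] [i' j'] /= /val_inj e; subst i' => /val_inj e.
by subst j'.
Qed.

Lemma nth_ltn_size (l : seq nat) i j : j < nth 0 l i -> i < size l.
Proof. by apply: contraTT; rewrite -!leqNgt => /(nth_default 0)->. Qed.

Definition mkbox (l : seq nat) i j (lt_j : j < nth 0 l i) : box l :=
  @Tagged _ (Ordinal (nth_ltn_size lt_j))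
    (fun i : 'I_(size l) => 'I_(nth 0 l i)) (Ordinal lt_j).

Lemma card_box l : #|{: box l}| = sumn l.
Proof.
rewrite card_tagged; congr sumn; apply: (@eq_from_nth _ 0).
  by rewrite size_map size_enum_ord.
move=> i; rewrite size_map size_enum_ord => lt_i.
by rewrite (nth_map (Ordinal lt_i)) ?size_enum_ord // card_ord nth_enum_ord.
Qed.

Definition embed_box (m l : seq nat) (le_ml : forall i, nth 0 m i <= nth 0 l i)
    (b : box m) : box l :=
  mkbox (leq_trans (ltn_ord (tagged b)) (le_ml (tag b))).

Section Branching.
Variables (m l : seq nat).
Hypothesis le_ml : forall i, nth 0 m i <= nth 0 l i.
Local Notation emb := (embed_box le_ml).

Lemma embed_box_inj : injective emb.
Proof.
by move=> b c e; apply: box_inj; [rewrite -[LHS]/(val (tag (emb b))) e|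
  rewrite -[LHS]/(val (tagged (emb b))) e].
Qed.

Lemma embed_boxP (b : box l) :
  tagged b < nth 0 m (tag b) -> exists c, emb c = b.
Proof. by move=> lt_b; exists (mkbox lt_b); apply: box_inj. Qed.

(** The inverse of deleting the largest entry: the boxes of l outside m receive the new value n. *)
Definition fill n (T : {ffun box m -> 'I_n}) : {ffun box l -> 'I_n.+1} :=
  [ffun b => if [pick c | emb c == b] is Some c then widen_ord (leqnSn n) (T c)
             else ord_max].

Lemma fill_emb n (T : {ffun box m -> 'I_n}) c : fill T (emb c) = T c :> nat.
Proof.
rewrite ffunE; case: pickP => [d /eqP/embed_box_inj -> //|/(_ c)].
by rewrite eqxx.
Qed.

Lemma fill_out n (T : {ffun box m -> 'I_n}) (b : box l) :
  nth 0 m (tag b) <= tagged b -> fill T b = n :> nat.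
Proof.
rewrite ffunE; case: pickP => [d /eqP <-|//].
by rewrite leqNgt /= ltn_ord.
Qed.

Lemma fill_ltn n (T : {ffun box m -> 'I_n}) (b : box l) :
  (fill T b < n) = (tagged b < nth 0 m (tag b)).
Proof.
have [/embed_boxP[c <-]|] := ltnP (tagged b) (nth 0 m (tag b)).
  by rewrite fill_emb ltn_ord.
by move/fill_out->; rewrite ltnn.
Qed.

Lemma fill_inj n : injective (@fill n).
Proof.
move=> S T e; apply/ffunP => c; apply: val_inj => /=.
by rewrite -fill_emb e fill_emb.
Qed.

Lemma fill_onto n (S : {ffun box l -> 'I_n.+1}) :
  (forall b, (S b < n) = (tagged b < nth 0 m (tag b))) ->
  exists T, S = fill T.
Proof.
move=> ltS; have ltE c : S (emb c) < n by rewrite ltS /= ltn_ord.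
exists [ffun c => Ordinal (ltE c)]; apply/ffunP => b; apply: val_inj => /=.
have [/embed_boxP[c <-]|le_b] := ltnP (tagged b) (nth 0 m (tag b)).
  by rewrite fill_emb ffunE.
rewrite fill_out //; apply/eqP; rewrite eqn_leq leq_ord leqNgt ltS.
by rewrite -leqNgt.
Qed.

Hypothesis interl : forall i, nth 0 l i.+1 <= nth 0 m i.

Lemma interlaceS i j : i < j -> nth 0 l j <= nth 0 m i.
Proof.
elim: j => // j IH; rewrite ltnS leq_eqVlt => /predU1P[-> //|/IH le_ji].
by rewrite (leq_trans (interl j)) // (leq_trans (le_ml j)).
Qed.

(** The new entry n exceeds all old ones, so the rows stay weakly increasing. By interlacing, a box
    of l that has another box below it lies in m, so n occurs only at the bottom of a column. *)
Lemma semistandard_fill n (T : {ffun box m -> 'I_n}) :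
  semistandard (fill T) = semistandard T.
Proof.
apply/semistandardP/semistandardP => sT b c.
  have [row col] := sT (emb b) (emb c); rewrite !fill_emb in row col.
  split; last exact: col.
  by move=> e le_bc; apply: row => //; apply: val_inj; rewrite /= e.
have [/embed_boxP[c' <-]|le_c] := ltnP (tagged c) (nth 0 m (tag c)); last first.
  rewrite (fill_out _ le_c); split=> [_ _|e lt_bc]; first exact: leq_ord.
  by rewrite fill_ltn e (leq_trans (ltn_ord _)) // interlaceS.
rewrite fill_emb; split=> [e le_bc|e lt_bc].
  have /embed_boxP[b' eb]: tagged b < nth 0 m (tag b).
    by apply: (leq_ltn_trans le_bc); rewrite e /=.
  rewrite -eb fill_emb; have [row _] := sT b' c'; apply: row.
    by apply: val_inj; move/(congr1 val): e; rewrite -eb.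
  by move: le_bc; rewrite -eb.
have /embed_boxP[b' eb]: tagged b < nth 0 m (tag b).
  by rewrite e (leq_trans (ltn_ord _)) // interlaceS.
rewrite -eb fill_emb; have [_ col] := sT b' c'.
by apply: col; move: e lt_bc; rewrite -eb.
Qed.

Lemma card_fiber_fill n (T : {ffun box m -> 'I_n}) (v : 'I_n) :
  #|[pred b | fill T b == widen_ord (leqnSn n) v]| = #|[pred b | T b == v]|.
Proof.
rewrite -(fintype.card_image embed_box_inj); apply: eq_card => b; rewrite !inE.
apply/eqP/fintype.imageP => [/(congr1 val) /= e|[c /eqP Tc ->]]; last first.
  by apply: val_inj; rewrite /= fill_emb Tc.
have /embed_boxP[c ec] : tagged b < nth 0 m (tag b) by rewrite -(fill_ltn T) e.
by exists c => //; rewrite inE; apply/eqP/val_inj; rewrite /= -e -ec fill_emb.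
Qed.

Lemma card_fiber_fill_max n (T : {ffun box m -> 'I_n}) :
  #|[pred b | fill T b == ord_max]| = sumn l - sumn m.
Proof.
rewrite -!card_box -(fintype.card_codom embed_box_inj) -(cardC (mem (codom
  emb))) addKn.
apply: eq_card => b; rewrite !inE -val_eqE /=.
apply/eqP/idP => [e|/codomP nb].
  by apply/codomP => -[c ec]; move: e (ltn_ord (T c));
    rewrite ec fill_emb => ->; rewrite ltnn.
by rewrite fill_out // leqNgt; apply/negP => /embed_boxP[c ec]; apply: nb;
  exists c.
Qed.

End Branching.

(* p constrains how often each entry may occur: predT gives the semistandard
   tableaux, and leq^~ 1 the standard ones when n is the number of boxes. *)
Definition tableau (p : pred nat) (l : seq nat) n : pred {ffun box l -> 'I_n} :=
  [pred T | semistandard T && [forall v, p #|[pred b | T b == v]|]].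

Lemma tableau_fill p m l (le_ml : forall i, nth 0 m i <= nth 0 l i) n
    (T : {ffun box m -> 'I_n}) :
  (forall i, nth 0 l i.+1 <= nth 0 m i) ->
  tableau p (fill le_ml T) = tableau p T && p (sumn l - sumn m).
Proof.
move=> interl; rewrite /tableau /= semistandard_fill // -andbA; congr andb.
apply/forallP/andP => [pT|[/forallP pT pmax v]].
  split; last by rewrite -(card_fiber_fill_max le_ml T).
  by apply/forallP => v; rewrite -(card_fiber_fill le_ml).
have [lt_v|] := ltnP v n.
  have -> : v = widen_ord (leqnSn n) (Ordinal lt_v) by apply: val_inj.
  by rewrite card_fiber_fill.
move=> le_v; have -> : v = ord_max by apply: val_inj => /=; apply/eqP;
  rewrite eqn_leq leq_ord.
by rewrite card_fiber_fill_max.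
Qed.

(** [fill] is a bijection from the tableaux of shape m onto the fillings counted here; the entry n
    then occurs |l| - |m| times, which [p] has to accept. *)
Lemma card_tableau_strip p m l n :
  (forall i, nth 0 m i <= nth 0 l i) -> (forall i, nth 0 l i.+1 <= nth 0 m i) ->
  #|[pred T : {ffun box l -> 'I_n.+1} | tableau p T &&
       [forall b, (T b < n) == (tagged b < nth 0 m (tag b))]]| =
  p (sumn l - sumn m) * #|[pred T : {ffun box m -> 'I_n} | tableau p T]|.
Proof.
move=> le_ml interl.
have [pD|npD] := boolP (p (sumn l - sumn m)); last first.
  rewrite mul0n; apply: eq_card0 => S; rewrite inE; apply/negP => /andP[pS].
  move=> /forallP ltS; case: (@fill_onto _ _ le_ml _ S) => [b|T eT].
    exact: (eqP (ltS b)).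
  by move: pS; rewrite eT tableau_fill // (negPf npD) andbF.
rewrite mul1n -(fintype.card_image (@fill_inj _ _ le_ml n));
  apply: eq_card => S.
rewrite inE; apply/andP/fintype.imageP => [[pS /forallP ltS]|[T pT ->]].
  case: (@fill_onto _ _ le_ml _ S) => [b|T eT]; first exact: (eqP (ltS b)).
  by exists T => //; move: pS; rewrite eT tableau_fill // pD andbT.
rewrite tableau_fill // pD andbT; split=> //.
by apply/forallP => b; rewrite fill_ltn.
Qed.

Definition tab_count (p : pred nat) l n :=
  #|[pred T : {ffun box l -> 'I_n} | tableau p T]|.

Lemma downset_threshold m (P : pred 'I_m) :
  (forall j j' : 'I_m, j <= j' -> P j' -> P j) ->
  exists2 c, c <= m & forall j, P j = (j < c).
Proof.
move=> downP; exists (\max_(j | P j) j.+1); first by apply/bigmax_leqP.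
move=> j; apply/idP/idP => [Pj|]; first exact: (bigop.bigmax_sup j).
apply: contraTT => nPj; rewrite -leqNgt; apply/bigmax_leqP => j' Pj'.
by rewrite ltnNge; apply: contra nPj => /downP/(_ Pj').
Qed.

(** Rows increase weakly, so the entries below k form an initial segment of each row. *)
Lemma semistandard_threshold l n (T : {ffun box l -> 'I_n.+1}) k i :
  semistandard T -> exists2 c, c <= nth 0 l i &
    forall b : box l, tag b = i :> nat -> (T b < k) = (tagged b < c).
Proof.
move=> /semistandardP sT; have [lt_i|le_i] := ltnP i (size l); last first.
  exists 0 => // b e; have := ltn_ord (tag b); rewrite [X in X < _]e.
  by rewrite ltnNge le_i.
pose f (j : 'I_(nth 0 l (Ordinal lt_i))) : box l :=
  @Tagged _ (Ordinal lt_i) (fun i : 'I_(size l) => 'I_(nth 0 l i)) j.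
have [j j' le_j|c le_c cP] := @downset_threshold _ [pred j | T (f j) < k].
  by apply: leq_ltn_trans; have [row _] := sT (f j) (f j'); apply: row.
exists c => // -[i' j] /= e; have {}e : i' = Ordinal lt_i by apply: val_inj.
by subst i'; apply: cP.
Qed.

(** * Partitions as finite functions, and the branching rule *)

Section Shapes.
Variables N B : nat.
Local Notation shape := {ffun 'I_N -> 'I_B}.

Definition parts (f : shape) : seq nat := [seq nat_of_ord (f i) | i <- enum
  'I_N].

Lemma size_parts f : size (parts f) = N.
Proof. by rewrite size_map size_enum_ord. Qed.

Lemma nth_parts f (i : 'I_N) : nth 0 (parts f) i = f i.
Proof. by rewrite (nth_map i) ?size_enum_ord // nth_ord_enum. Qed.

Lemma nth_parts_out f i : N <= i -> nth 0 (parts f) i = 0.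
Proof. by move=> le_i; rewrite nth_default ?size_parts. Qed.

Lemma sumn_parts f : sumn (parts f) = \sum_i f i.
Proof. by rewrite sumnE big_map big_enum. Qed.

(** The default value 0 of [nth] makes the condition hold for the last row. *)
Definition nonincr (f : shape) :=
  [forall i : 'I_N, nth 0 (parts f) i.+1 <= f i].

(* f / g is a horizontal strip. *)
Definition strip (f g : shape) :=
  [forall i : 'I_N, nth 0 (parts f) i.+1 <= g i <= f i].

Lemma stripP f g :
  reflect ((forall i, nth 0 (parts g) i <= nth 0 (parts f) i) /\
           (forall i, nth 0 (parts f) i.+1 <= nth 0 (parts g) i))
    (strip f g).
Proof.
apply: (iffP forallP) => [fg|[le_gf le_fg] i]; last first.
  by rewrite -!nth_parts le_fg le_gf.
split=> i; have [lt_i|le_i] := ltnP i N; rewrite ?(nth_parts_out _ le_i) //.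
  by have /andP[_] := fg (Ordinal lt_i); rewrite -!nth_parts.
  by have /andP[] := fg (Ordinal lt_i); rewrite -!nth_parts.
by rewrite nth_parts_out // ltnW.
Qed.

Lemma nonincrP f :
  reflect (forall i, nth 0 (parts f) i.+1 <= nth 0 (parts f) i) (nonincr f).
Proof.
apply: (iffP forallP) => [df i|df i]; last by rewrite -nth_parts.
have [lt_i|le_i] := ltnP i N; first by rewrite (nth_parts f (Ordinal lt_i));
  exact: (df (Ordinal lt_i)).
by rewrite nth_parts_out // ltnW.
Qed.

Lemma nonincr_strip f g : strip f g -> nonincr g.
Proof.
move=> /stripP[le_gf le_fg]; apply/nonincrP => i.
exact: leq_trans (le_gf _) (le_fg _).
Qed.

(* g is the shape formed by the entries smaller than n. *)
Lemma tab_count_branch p (f : shape) n : nonincr f ->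
  tab_count p (parts f) n.+1 =
  \sum_(g | strip f g) p (sumn (parts f) - sumn (parts g)) *
                       tab_count p (parts g) n.
Proof.
move=> df; pose below (g : shape) (T : {ffun box (parts f) -> 'I_n.+1}) :=
  [forall b, (T b < n) == (tagged b < nth 0 (parts g) (tag b))].
(* Sort the tableaux by the shape [g] of their entries below n. *)
transitivity (\sum_(g | strip f g) #|[pred T | tableau p T && below g T]|).
  under [RHS]eq_bigr do rewrite -sum1_card big_mkcondr /=.
  rewrite exchange_big /= /tab_count -sum1_card.
  apply: eq_bigr => T /andP[sT _].
  (* The row thresholds [u] give the only candidate [g0] for that shape. *)
  have /fin_all_exists[u uP] (i : 'I_N) : exists c : 'I_B, c <= f i /\
      forall b : box (parts f), tag b = i :> nat -> (T b < n) = (tagged b < c).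
    have [c le_c cP] := semistandard_threshold n i sT.
    rewrite nth_parts in le_c.
    by exists (Ordinal (leq_ltn_trans le_c (ltn_ord _))).
  pose g0 : shape := [ffun i => u i].
  have g0P (b : box (parts f)) : (T b < n) = (tagged b < nth 0 (parts g0) (tag
    b)).
    have lt_b := ltn_ord (tag b); rewrite [X in _ < X]size_parts in lt_b.
    have [_ /(_ b) ->] := uP (Ordinal lt_b) => //.
    by rewrite (nth_parts g0 (Ordinal lt_b)) ffunE.
  have sg0 : strip f g0.
    apply/forallP => i; rewrite ffunE; have [-> uiP] := uP i; rewrite andbT.
    (* If row i + 1 of [f] were longer than [u i], column [u i] would meet rows i and i + 1; the
       upper box holds an entry at least n, which the lower one would have to exceed. *)
    rewrite leqNgt; apply/negP => lt_u; have := lt_u.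
    move/nonincrP/(_ i): (df); rewrite nth_parts => le_f.
    have lt_u' : u i < nth 0 (parts f) i by rewrite nth_parts (leq_trans lt_u).
    have /semistandardP/(_ (mkbox lt_u') (mkbox lt_u))[_ col] := sT.
    have /(leq_trans (col (erefl _) _)) := leq_ord (T (mkbox lt_u)).
    by rewrite /= ltnS leqnn uiP //= ltnn => /(_ isT).
  rewrite -big_mkcondr (big_pred1 g0) // => g; rewrite /= /below.
  apply/andP/eqP => [[/stripP[le_gf _] /forallP gP]|->]; last first.
    by split=> //; apply/forallP => b; rewrite g0P.
  apply/ffunP => i; apply: val_inj; rewrite /= -!nth_parts.
  have /stripP[le_g0 _] := sg0.
  (* [g] and [g0] cut row i of [f] at the same place, and both lie inside [f], so they agree. *)
  have gg0 j : j < nth 0 (parts f) i ->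
      (j < nth 0 (parts g) i) = (j < nth 0 (parts g0) i).
    by move=> lt_j; have /eqP := gP (mkbox lt_j); rewrite g0P.
  apply/eqP; rewrite eqn_leq; apply/andP; split; rewrite leqNgt;
    apply/negP => lt_g.
    by have := gg0 _ (leq_trans lt_g (le_gf i)); rewrite lt_g ltnn.
  by have := gg0 _ (leq_trans lt_g (le_g0 i)); rewrite lt_g ltnn.
apply: eq_bigr => g /stripP[le_gf le_fg].
exact: card_tableau_strip.
Qed.

End Shapes.

Lemma tab_count0 p l : tab_count p l 0 = (sumn l == 0).
Proof.
have cardT : #|{ffun box l -> 'I_0}| = (sumn l == 0).
  by rewrite card_ffun card_ord card_box; case: (sumn l) => // s; rewrite exp0n.
have [/eqP s0|s0] := boolP (sumn l == 0); last first.
  apply/eqP; rewrite -leqn0 (leq_trans (max_card _)) //.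
  by rewrite cardT (negPf s0).
rewrite s0 eqxx in cardT; rewrite -[RHS]cardT; apply: eq_card => T.
rewrite !inE; apply/andP; split; last by apply/forallP => -[].
apply/semistandardP => b; suff: box l -> False by case.
by move=> c; have := card_box l; rewrite s0 => /card0_eq/(_ c).
Qed.

(** The two sequences can differ only by trailing zeros, but these change the type [box]; tableaux
    are pulled back along the identification of boxes. The hypothesis is symmetric, so equality
    follows. *)
Lemma tab_count_le p (m l : seq nat) n :
  (forall i, nth 0 m i = nth 0 l i) -> tab_count p l n <= tab_count p m n.
Proof.
move=> e_ml; have le_ml i : nth 0 m i <= nth 0 l i by rewrite e_ml.
pose emb := embed_box le_ml.
have embI : injective emb := embed_box_inj (le_ml := le_ml).
have embS b : exists c, emb c = b.
  by apply: embed_boxP; rewrite e_ml ltn_ord.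
pose pull (T : {ffun box l -> 'I_n}) := [ffun c => T (emb c)].
have pullI : injective pull.
  move=> S T /ffunP e; apply/ffunP => b; have [c <-] := embS b.
  by have := e c; rewrite !ffunE.
rewrite /tab_count -(fintype.card_image pullI); apply: subset_leq_card.
apply/fintype.subsetP => _ /fintype.imageP[T /andP[/semistandardP sT /forallP
  pT] ->].
apply/andP; split.
  apply/semistandardP => b c; rewrite !ffunE.
  have [row col] := sT (emb b) (emb c); split=> [e|]; last exact: col.
  by apply: row; apply: val_inj; rewrite /= e.
apply/forallP => v; have := pT v; congr p.
rewrite -(fintype.card_image embI); apply: eq_card => b; rewrite !inE.
apply/idP/fintype.imageP => [Tb|[c]].
  by have [c ec] := embS b; exists c => //; rewrite inE ffunE ec.
by rewrite inE ffunE => Tc ->.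
Qed.

Lemma eq_tab_count p (m l : seq nat) n :
  (forall i, nth 0 m i = nth 0 l i) -> tab_count p l n = tab_count p m n.
Proof. by move=> e; apply/eqP; rewrite eqn_leq !tab_count_le. Qed.

Lemma num_sytE l : num_syt l = tab_count (leq^~ 1) l (sumn l).
Proof.
rewrite /num_syt cardsE; apply: eq_card => T; rewrite !inE /standard.
congr andb; apply/injectiveP/forallP => [injT v|leT b c eT].
  by apply/card_le1_eqP => b c /eqP eb /eqP ec; apply: injT; rewrite eb.
by have /card_le1_eqP := leT (T b); apply; rewrite !inE // eT.
Qed.

(** Pigeonhole: with at most one box per entry, n entries fill at most n boxes. *)
Lemma tab_count_inj_small l n : n < sumn l -> tab_count (leq^~ 1) l n = 0.
Proof.
move=> lt_n; apply: eq_card0 => T; apply/negP => /andP[_ /forallP leT].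
have: sumn l <= n.
  rewrite -card_box -sum1_card (partition_big T predT) //=.
  rewrite -[leqRHS]card_ord -sum1_card; apply: leq_sum => v _.
  by rewrite sum1_card; apply: leT.
by rewrite leqNgt lt_n.
Qed.

(** Columns increase strictly, so the entry of row i in the first column is at least i. *)
Lemma tab_count_tall p l n : n < size l -> 0 \notin l -> tab_count p l n = 0.
Proof.
move=> lt_n l0; apply: eq_card0 => T; apply/negP => /andP[/semistandardP sT _].
have gt0 i : i < size l -> 0 < nth 0 l i.
  by move=> lt_i; rewrite lt0n; apply: contraNneq l0 => <-; apply: mem_nth.
have leT i (lt_i : i < size l) : i <= T (mkbox (gt0 i lt_i)).
  elim: i lt_i => [//|i IHi] lt_i.
  apply: leq_ltn_trans (IHi (ltnW lt_i)) _.
  by have [_ col] := sT (mkbox (gt0 i (ltnW lt_i))) (mkbox (gt0 _ lt_i));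
    apply: col.
by have := leq_ltn_trans (leT n lt_n) (ltn_ord _); rewrite ltnn.
Qed.

End Tableaux.

(** * The number of semistandard tableaux *)

(** Multilinearity in the rows: one index c is chosen in each row, and [g] records the choices. *)
Lemma det_sum_rows (R : comNzRingType) n B (Q : 'I_n -> pred 'I_B)
    (F : 'I_n -> 'I_B -> 'I_n -> R) :
  \det (\matrix_(i, j) \sum_(c | Q i c) F i c j) =
  \sum_(g : {ffun 'I_n -> 'I_B} | [forall i, Q i (g i)])
    \det (\matrix_(i, j) F i (g i) j).
Proof.
rewrite /determinant exchange_big; apply: eq_bigr => s _ /=.
rewrite -mulr_sumr; congr (_ * _); under eq_bigr do rewrite mxE.
rewrite (bigA_distr_big_dep _ (fun i c => F i c (s i))).
by apply: eq_bigr => g _; apply: eq_bigr => i _; rewrite mxE.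
Qed.

Lemma det_upper_unitriangular (R : comNzRingType) n (A : 'M[R]_n) :
  (forall i j : 'I_n, (j < i)%N -> A i j = 0) -> (forall i, A i i = 1) ->
  \det A = 1.
Proof.
move=> Aut A1; rewrite -det_tr det_trig ?big1 // => [i _|];
  first by rewrite mxE.
by apply/is_trig_mxP => i j lt_ij; rewrite mxE Aut.
Qed.

(** * Complete homogeneous symmetric polynomials at 1^n *)

Section CompleteSymmetric.
Local Open Scope nat_scope.

(* The value at 1^n of the complete homogeneous symmetric polynomial of degree
   x - m, which is 0 when x < m. *)
Fixpoint ncompl (m n x : nat) : nat :=
  if n is n'.+1 then (\sum_(y < x.+1) ncompl m n' y)%N else x == m.

Lemma ncompl_eq0 m n x : (x < m)%N -> ncompl m n x = 0%N.
Proof.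
elim: n x => [|n IH] x lt_xm /=; first by rewrite ltn_eqF.
by apply: big1 => y _; rewrite IH // (leq_ltn_trans _ lt_xm) // -ltnS.
Qed.

(** Raising r by one adds one term to the defining sum, which is Pascal's rule; hence a double
    induction on n and r. *)
Lemma ncomplE m n r : ncompl m n.+1 (m + r)%N = 'C(r + n, n).
Proof.
elim: n r => [|n IHn] r.
  rewrite /= bin0 (bigD1 (inord m : 'I_(m + r).+1)) //= inordK ?ltnS ?leq_addr
    //.
  rewrite eqxx big1 ?addn0 // => y;
    rewrite -val_eqE /= inordK ?ltnS ?leq_addr //.
  by move/negPf->.
elim: r => [|r IHr].
  rewrite addn0 add0n binn -[LHS]/(\sum_(y < m.+1) ncompl m n.+1 y)%N.
  rewrite big_ord_recr /= big1 => [|y _].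
    by rewrite add0n -[RHS](binn n) -[n in 'C(n, _)]add0n -IHn addn0.
  exact: (@ncompl_eq0 _ n.+1).
have -> : ncompl m n.+2 (m + r.+1) =
    (ncompl m n.+2 (m + r) + ncompl m n.+1 (m + r.+1))%N.
  by rewrite [LHS]/= big_ord_recr /= !addnS.
by rewrite IHr IHn -[RHS]/('C((r + n.+1).+1, n.+1)) [RHS]binS addSnnS.
Qed.

Lemma ncompl_bin m x : ncompl m m.+1 x = 'C(x, m).
Proof.
have [lt_xm|le_mx] := ltnP x m; first by rewrite ncompl_eq0 // bin_small.
by rewrite -(subnKC le_mx) ncomplE addnC.
Qed.

End CompleteSymmetric.

Lemma sum_ord_interval (R : nmodType) B lo hi (F : nat -> R) : (hi < B)%N ->
  \sum_(c < B | (lo <= c <= hi)%N) F c = \sum_(lo <= c < hi.+1) F c.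
Proof.
move=> lt_hi; rewrite -(big_mkord (fun c => lo <= c <= hi)%N).
rewrite (big_cat_nat (n := hi.+1)) //= [X in _ + X]big1_seq => [|i]; last first.
  rewrite mem_index_iota => /andP[/andP[_ le_hi] /andP[lt_hi' _]].
  by move: (leq_trans lt_hi' le_hi); rewrite ltnn.
rewrite addr0 [RHS](big_nat_widenl lo 0) // [LHS]big_nat_cond [RHS]big_nat_cond.
by apply: eq_bigl => i; rewrite ltnS; case: (i <= hi)%N; rewrite ?andbF ?andbT.
Qed.

Section SchurDimension.
Variables (R : comNzRingType) (m B : nat).
Local Notation shape := {ffun 'I_m.+1 -> 'I_B}.

(* The strictly decreasing coordinates lambda_i + N - i, with N = m.+1. *)
Definition shifted (f : shape) (i : 'I_m.+1) : nat := f i + (m - i).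

(** The partial sums of [ncompl m n] are [ncompl m n.+1], so the sum telescopes. Its lower end is
    the entry of row i + 1, as f_(i+1) + (m - i) is one more than the shifted coordinate of that
    row; in the last row only arguments below m are left, where [ncompl] vanishes. *)
Lemma strip_sum_ncompl n (f : shape) (i j : 'I_m.+1) : nonincr f ->
  \sum_(c < B | (nth 0 (parts f) i.+1 <= c <= f i)%N)
     (ncompl m n (c + (m - i) + j))%:R =
  (ncompl m n.+1 (shifted f i + j))%:R -
  (if (i < m)%N then (ncompl m n.+1 (shifted f (inord i.+1) + j))%:R else 0) :>
    R.
Proof.
move=> df; rewrite (@sum_ord_interval _ B _ _
  (fun c => (ncompl m n (c + (m - i) + j))%:R)) //.
pose S x : R := \sum_(0 <= y < x) (ncompl m n y)%:R.
have SE x : (ncompl m n.+1 x)%:R = S x.+1 by rewrite /S big_mkord /= natr_sum.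
transitivity (S (f i + (m - i) + j).+1 - S (nth 0 (parts f) i.+1 + (m - i) +
  j)%N).
  rewrite -addSn -addSn.
  rewrite -(telescope_sumr (fun c => S (c + (m - i) + j)%N)); last first.
    by rewrite -nth_parts leqW // (nonincrP _ df).
  apply: eq_bigr => c _.
  by rewrite !addSn /S big_nat_recr //= addrAC subrr add0r.
rewrite -SE /shifted; congr (_ - _).
have [lt_im|le_mi] := ltnP i m.
  rewrite SE; congr S. rewrite -nth_parts inordK //.
  by rewrite -addSn; congr addn; rewrite -addnS -subSn.
rewrite nth_parts_out // add0n (_ : (m - i = 0)%N) ?add0n; last first.
  by apply/eqP; rewrite subn_eq0.
rewrite /S big_nat_cond big1 // => y /andP[/andP[_ lt_y] _].
by rewrite ncompl_eq0 // (leq_trans lt_y) // leq_ord.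
Qed.

(** An integral form of Weyl's dimension formula: over the rationals, the product of (L_i - L_j) /
    (j - i) over i < j. *)
Definition binom_det (L : 'I_m.+1 -> nat) : R :=
  \det (\matrix_(i, j) 'C(L i, m - j)%:R).

(* Jacobi-Trudi at 1^n. Multilinearity turns the sum over strips into a
   telescoping sum in each row, i.e. into a difference of consecutive rows of
   the next determinant. *)
Lemma tab_count_ncompl n (f : shape) : nonincr f ->
  (tab_count predT (parts f) n)%:R =
  \det (\matrix_(i, j) (ncompl m n (shifted f i + j))%:R) :> R.
Proof.
elim: n f => [|n IHn] f df.
  (* For n = 0 the entry at (i, j) is 1 exactly when f_i + j = i, so the empty partition gives the
     identity matrix. *)
  rewrite tab_count0; have [s0|s0] := boolP (_ == _).
    have f0 i : f i = 0%N :> nat.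
      by move: s0; rewrite sumn_parts sum_nat_eq0 => /forallP/(_ i)/eqP.
    rewrite det_upper_unitriangular // => [i j lt_ji|i];
      rewrite mxE /shifted f0 /=.
      rewrite add0n ltn_eqF // -[ltnRHS](@subnK i) ?leq_ord //.
      by rewrite ltn_add2l.
    by rewrite subnK ?leq_ord ?eqxx.
  (* A nonzero partition has a positive first part, and then the first row of the matrix
     vanishes. *)
  have f0 : (0 < f ord0)%N.
    rewrite lt0n; apply: contraNN s0 => /eqP f0.
    have p0 i : nth 0%N (parts f) i = 0%N.
      elim: i => [|i IHi]; first by rewrite (nth_parts f ord0).
      by have := nonincrP _ df i; rewrite IHi leqn0 => /eqP.
    by rewrite sumn_parts sum_nat_eq0; apply/forallP => i;
      rewrite -nth_parts p0.
  rewrite (expand_det_row _ ord0) big1 // => j _.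
  rewrite mxE /shifted /= subn0 gtn_eqF ?mul0r // addnAC.
  by rewrite addnC -[ltnLHS]addn0 ltn_add2l addn_gt0 f0.
rewrite tab_count_branch // natr_sum.
transitivity (\sum_(g : shape | strip f g)
   \det (\matrix_(i, j) ((ncompl m n (shifted g i + j))%:R : R))).
  by apply: eq_bigr => g /nonincr_strip dg; rewrite mul1n IHn.
rewrite -(@det_sum_rows R _ _ (fun i c => nth 0 (parts f) i.+1 <= c <= f i)%N
  (fun i c j => (ncompl m n (c + (m - i) + j))%:R)).
(* Left multiplication by [T] subtracts from each row the next one and keeps the determinant. *)
pose T : 'M[R]_m.+1 := \matrix_(i, k) ((i == k)%:R - (k == i.+1 :> nat)%:R).
have detT : \det T = 1.
  apply: det_upper_unitriangular => [i j lt_ji|i]; rewrite mxE.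
    by rewrite -val_eqE /= gtn_eqF // ltn_eqF ?subr0 // ltnW.
  by rewrite eqxx ltn_eqF ?subr0.
set M := (X in _ = \det X).
transitivity (\det (T *m M)); last by rewrite det_mulmx detT mul1r.
congr determinant.
apply/matrixP => i j; rewrite !mxE strip_sum_ncompl //.
rewrite (bigD1 i) //= !mxE eqxx ltn_eqF // subr0 mul1r; congr (_ + _).
case: ltnP => [lt_im|le_mi].
  have ni : inord i.+1 != i by rewrite -val_eqE /= inordK // gtn_eqF.
  rewrite [RHS](bigD1 (inord i.+1)) //= !mxE inordK // eqxx eq_sym (negPf ni)
    sub0r mulN1r.
  rewrite [X in _ + X]big1 ?addr0 // => k /andP[ki kn];
    rewrite !mxE eq_sym (negPf ki).
  move: kn; rewrite -val_eqE /= inordK // => /negPf->.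
  by rewrite subr0 mul0r.
rewrite oppr0 [RHS]big1 // => k ki; rewrite !mxE eq_sym (negPf ki).
by rewrite ltn_eqF ?subr0 ?mul0r // ltnS (leq_trans _ le_mi) // leq_ord.
Qed.

(** For n = m + 1 the Jacobi-Trudi entries are C(L_i + j, m), and Vandermonde's convolution factors
    their matrix as that of [binom_det] times the unitriangular [W]. *)
Lemma tab_count_semistandard (f : shape) : nonincr f ->
  (tab_count predT (parts f) m.+1)%:R = binom_det (shifted f).
Proof.
move=> df; rewrite tab_count_ncompl //.
pose W : 'M[R]_m.+1 := \matrix_(t, j) 'C(j, t)%:R.
have detW : \det W = 1.
  apply: det_upper_unitriangular => [i j lt_ji|i]; rewrite mxE ?binn //.
  by rewrite bin_small.
rewrite /binom_det; set M := (X in _ = \det X).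
transitivity (\det (M *m W)); last by rewrite det_mulmx detW mulr1.
congr determinant.
apply/matrixP => i j; rewrite !mxE ncompl_bin addnC -binomial.Vandermonde.
rewrite natr_sum; apply: eq_bigr => t _.
by rewrite !mxE -natrM mulnC.
Qed.

End SchurDimension.

(** * Standard tableaux as walks in the chamber *)

Lemma schur1E (R : comNzRingType) N l : schur1 R N l = (tab_count predT l N)%:R.
Proof.
rewrite /schur1 /schur (big_morph _ (mpoly.mevalD _) (mpoly.meval0 _)).
rewrite /tab_count -sum1_card natr_sum.
apply: eq_big => [T|T _].
  by rewrite inE /tableau /=; case: semistandard => //=; apply/esym/forallP.
rewrite (big_morph _ (mpoly.mevalM _) (mpoly.meval1 _)) big1 // => b _.
exact: mpoly.mevalXU.
Qed.

Section Paths.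
Variables (R : numDomainType) (N : nat).
Implicit Type (g : ('I_N -> nat) -> R) (L : 'I_N -> nat).

Definition add_at L (i : 'I_N) : 'I_N -> nat := fun j => (L j + (j == i))%N.

Definition up g L : R := \sum_i g (add_at L i).

Definition alternating g :=
  forall (s : 'S_N) L, g (L \o s) = (-1) ^+ s * g L.

(** Swapping the two equal coordinates gives g L = - g L, and 2 is not a zero divisor. *)
Lemma alternating_eq0 g L i j :
  alternating g -> i != j -> L i = L j -> g L = 0.
Proof.
move=> altg neq_ij e; have := altg (tperm i j) L.
have -> : L \o tperm i j = L.
  by apply/funext => k /=; case: tpermP => // ->.
rewrite odd_tperm neq_ij expr1 mulN1r => /eqP.
by rewrite -addr_eq0 -mulr2n mulrn_eq0 /= => /eqP.
Qed.

Lemma alternating_up g : alternating g -> alternating (up g).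
Proof.
move=> altg s L; rewrite /up mulr_sumr [RHS](reindex_inj (@perm_inj _ s)) /=.
apply: eq_bigr => i _; rewrite -altg; congr g; apply/funext => j /=.
by rewrite /add_at /= (inj_eq (@perm_inj _ s)).
Qed.

End Paths.

Section StandardTableaux.
Variables (R : numDomainType) (m B : nat).
Local Notation shape := {ffun 'I_m.+1 -> 'I_B}.

(** A step L_i -> L_i + 1 either adds a box to [f] or ends on a wall of the chamber, where [g]
    vanishes. The bound on B leaves room for the larger shapes. *)
Lemma strip_sum_up (g : ('I_m.+1 -> nat) -> R) (f : shape) :
  alternating g -> nonincr f -> ((sumn (parts f)).+1 < B)%N ->
  \sum_(h : shape | [&& nonincr h, strip h f &
                        sumn (parts h) == (sumn (parts f)).+1]) g (shifted h) =
  up g (shifted f).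
Proof.
move=> altg df ltB.
have f_lt i : (f i + 1 < B)%N.
  rewrite addn1 (leq_ltn_trans _ ltB) // ltnS sumn_parts.
  by rewrite (bigD1 i) //= leq_addr.
have d_lt (i j : 'I_m.+1) : (f j + (j == i) < B)%N.
  by apply: leq_ltn_trans (f_lt j); rewrite leq_add2l leq_b1.
pose add i : shape := [ffun j => Ordinal (d_lt i j)].
have addE i j : add i j = (f j + (j == i))%N :> nat by rewrite ffunE.
have add_inj : injective add.
  move=> i j /ffunP/(_ i)/(congr1 val); rewrite /= !addE eqxx.
  by move/addnI; case: eqP.
have sum_add i : sumn (parts (add i)) = (sumn (parts f)).+1.
  rewrite !sumn_parts; under eq_bigr do rewrite addE.
  rewrite big_split /= -[RHS]addn1; congr (_ + _)%N.
  by rewrite (bigD1 i) //= eqxx big1 // => j /negPf->.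
have shift_add i : shifted (add i) = add_at (shifted f) i.
  by apply/funext => j; rewrite /shifted addE /add_at addnAC.
have addS i (j : 'I_m.+1) : (j < m)%N ->
    nth 0%N (parts (add i)) j.+1 = (nth 0%N (parts f) j.+1 + (inord j.+1 ==
      i))%N.
  by move=> lt_j; have := nth_parts (add i) (inord j.+1);
    have := nth_parts f (inord j.+1); rewrite inordK // => -> ->; rewrite addE.
rewrite /up (bigID (fun i => nonincr (add i))) /= [X in _ = _ + X]big1 ?addr0.
  transitivity (\sum_(h in (add @: [set i | nonincr (add i)])%SET) g (shifted
    h)).
    apply: eq_bigl => h; apply/and3P/imsetP => [[dh /stripP[le_fh _] /eqP
      sh]|[i]]; last first.
      rewrite inE => dai ->; split; rewrite ?sum_add //.
      apply/forallP => j; rewrite addE leq_addr andbT.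
      have [lt_jm|le_mj] := ltnP j m; last by rewrite nth_parts_out.
      have := nonincrP _ dai j; rewrite addS // nth_parts addE.
      have := nonincrP _ df j; rewrite nth_parts.
      case: eqP => [<-|]; last by rewrite addn0.
      by rewrite -val_eqE /= inordK // ltn_eqF // addn0.
    (* One more box in total, with no row shortened: exactly one row grew, by one. *)
    have : (\sum_j (h j - f j) == 1)%N.
      rewrite sumnB => [|j _]; last by rewrite -!nth_parts.
      by rewrite -!sumn_parts sh subSnn.
    case/sum_nat_eq1 => i [_ hi hj].
    have eh : h = add i.
      apply/ffunP => j; apply: val_inj; rewrite /= addE.
      have le_f : (f j <= h j)%N by rewrite -!nth_parts.
      rewrite -(subnKC le_f); congr (_ + _)%N.
      by case: eqP => [->|/eqP/hj ->].
    by exists i => //; rewrite inE -eh.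
  rewrite big_imset /=; last by move=> i j _ _; apply: add_inj.
  by apply: eq_big => i; rewrite ?inE // => _; rewrite shift_add.
move=> i; rewrite negb_forall => /existsP[j]; rewrite -ltnNge.
have [lt_jm|le_mj] := ltnP j m; last by rewrite nth_parts_out.
rewrite addS // addE.
have le_f := nonincrP _ df j; rewrite nth_parts in le_f.
have [ei lt_f|] := eqVneq (inord j.+1) i; last first.
  by rewrite addn0 => _ lt_f; have := leq_trans lt_f le_f;
    rewrite ltnNge leq_addr.
have ji : (j == i) = false by rewrite -ei -val_eqE /= inordK // ltn_eqF.
rewrite ji addn0 addn1 ltnS in lt_f.
(* The order can only fail at i = j + 1 with f_j = f_i; the step then makes the shifted coordinates
   of rows j and i equal. *)
apply: (@alternating_eq0 _ _ _ _ j i altg); first by rewrite ji.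
have ef : nth 0%N (parts f) j.+1 = f j by apply/eqP; rewrite eqn_leq le_f.
rewrite /add_at ji eqxx addn0 /shifted -ei -(nth_parts f (inord j.+1)) inordK
  //.
by rewrite ef -addnA addn1 subnSK.
Qed.

(** Removing the largest entry turns the sum of [g] over shapes of size n + 1 into the sum of [up g]
    over shapes of size n. As n < B, no partition of n with at most m + 1 parts is missed. *)
Lemma sum_syt_iter_up (g : ('I_m.+1 -> nat) -> R) n :
  alternating g -> (n < B)%N ->
  \sum_(f : shape | nonincr f && (sumn (parts f) == n))
     (tab_count (leq^~ 1%N) (parts f) n)%:R * g (shifted f) =
  iter n (@up R m.+1) g (fun i => m - i)%N.
Proof.
elim: n g => [|n IHn] g altg ltB.
  pose f0 : shape := [ffun=> Ordinal ltB].
  have p0 i : nth 0%N (parts f0) i = 0%N.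
    have [lt_i|le_i] := ltnP i m.+1; last by rewrite nth_parts_out.
    by rewrite (nth_parts f0 (Ordinal lt_i)) ffunE.
  rewrite (big_pred1 f0) => [|f].
    rewrite tab_count0 sumn_parts big1 => [|i _]; last by rewrite ffunE.
    rewrite eqxx mul1r; congr g; apply/funext => i.
    by rewrite /shifted ffunE.
  apply/andP/eqP => [[_]|->].
    rewrite sumn_parts sum_nat_eq0 => /forallP f_0.
    apply/ffunP => i; apply: val_inj; rewrite ffunE /=.
    by have /eqP := f_0 i.
  split; first by apply/nonincrP => i; rewrite !p0.
  by rewrite sumn_parts big1 // => i _; rewrite ffunE.
rewrite iterSr -(IHn _ (alternating_up altg) (ltnW ltB)).
transitivity (\sum_(f : shape | nonincr f && (sumn (parts f) == n.+1))
  \sum_(h : shape | strip f h && (sumn (parts h) == n))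
    (tab_count (leq^~ 1%N) (parts h) n)%:R * g (shifted f)).
  apply: eq_bigr => f /andP[df /eqP sf].
  rewrite tab_count_branch // natr_sum mulr_suml [RHS]big_mkcondr /=.
  apply: eq_bigr => h /stripP[le_hf _]; rewrite sf.
  have le_s : (sumn (parts h) <= n.+1)%N.
    by rewrite -sf !sumn_parts; apply: leq_sum => i _; rewrite -!nth_parts.
  (* Only [h] of size n contributes: a smaller one would repeat the largest entry, a larger one has
     more boxes than entries. *)
  have [->|ne_n] := eqVneq (sumn (parts h)) n; first by rewrite subSnn mul1n.
  have [lt_n|le_n] := ltnP n (sumn (parts h)).
    by rewrite tab_count_inj_small // muln0 mul0r.
  have -> : (n.+1 - sumn (parts h) <= 1)%N = false.
    by rewrite leq_subLR addn1 ltnS leqNgt ltn_neqAle ne_n le_n.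
  by rewrite mul0r.
rewrite (exchange_big_dep (fun h : shape => nonincr h && (sumn (parts h) ==
  n))) /=.
  apply: eq_bigr => h /andP[dh /eqP sh].
  rewrite -mulr_sumr -strip_sum_up ?sh //; congr (_ * _).
  by apply: eq_bigl => f; rewrite eqxx andbT andbAC andbA.
by move=> f h _ /andP[/nonincr_strip -> ->].
Qed.

End StandardTableaux.

(** * Moments on the staircase *)

Section Newton.
Local Open Scope nat_scope.

(** Both sides count the t-subsets of an x-set with an ordered choice of k of their elements. *)
Lemma bin_mul_ffact x t k : k <= t ->
  'C(x, t) * t ^_ k = x ^_ k * 'C(x - k, t - k).
Proof.
elim: k x t => [|k IHk] x [|t] //; first by rewrite !ffactn0 !subn0 mul1n muln1.
  by rewrite !ffactn0 !subn0 mul1n muln1.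
rewrite ltnS => le_kt; case: x => [|x]; first by rewrite bin0n ffact0n.
by rewrite !ffactSS !subSS -mulnA -IHk // !mulnA [_ * t.+1]mulnC -mul_bin_diag.
Qed.

Lemma sum_ord_support (G : nat -> nat) a K : a <= K ->
  (forall v, a <= v -> G v = 0) -> \sum_(v < K) G v = \sum_(v < a) G v.
Proof.
move=> le_aK G0; rewrite -!(big_mkord xpredT G) (big_cat_nat (n := a)) //=.
rewrite [X in _ + X]big_nat_cond [X in _ + X]big1 ?addn0 // => v
  /andP[/andP[le_a _] _].
exact: G0.
Qed.

(** By [bin_mul_ffact] and t = k + v this is Vandermonde's convolution for x = (x - k) + k. Any M
    above x will do, since C(x, t) = 0 for t > x. *)
Lemma ffact_mul_bin x k p M : x < M ->
  \sum_(t < M | p <= t) 'C(x, t) * t ^_ k * 'C(k, t - p) = x ^_ k * 'C(x, p).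
Proof.
move=> lt_xM; rewrite big_mkcond /=.
have [lt_xk|le_kx] := ltnP x k.
  rewrite ffact_small // mul0n big1 // => t _; case: ifP => // _.
  have [lt_xt|le_tx] := ltnP x t; first by rewrite bin_small.
  by rewrite (@ffact_small t) ?muln0 // (leq_ltn_trans le_tx).
pose G t := if p <= t then 'C(x, t) * t ^_ k * 'C(k, t - p) else 0.
rewrite -(big_mkord xpredT G) (big_cat_nat (n := k)) //=; last first.
  by rewrite (leq_trans le_kx) // ltnW.
rewrite big_nat_cond big1 ?add0n => [|t /andP[/andP[_ lt_t] _]]; last first.
  by rewrite /G (@ffact_small t) // muln0 if_same.
rewrite -{1}[k]add0n big_addn big_mkord.
pose H v := 'C(x - k, v) * (if v <= p then 'C(k, p - v) else 0).
transitivity (x ^_ k * \sum_(v < M - k) H v).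
  rewrite big_distrr; apply: eq_bigr => v _; rewrite /G /H.
  rewrite bin_mul_ffact ?leq_addl // addnK -mulnA.
  case: leqP => [le_p|lt_p]; last first.
    have -> : 'C(k, p - v) = 0 by apply: bin_small; rewrite ltn_subRL.
    by rewrite if_same /= !muln0.
  case: leqP => [le_vp|lt_pv]; last by rewrite /= (@bin_small k) ?muln0 //; lia.
  rewrite -(@bin_sub k (p - v)); last by rewrite leq_subLR.
  by rewrite subnBA // addnC.
congr (_ * _); rewrite -[in RHS](subnK le_kx) -binomial.Vandermonde.
(* The two sums have different ranges; both are cut to the common support v <= min(x - k, p). *)
have H0 v : minn (x - k).+1 p.+1 <= v -> H v = 0.
  rewrite geq_min /H => /orP[lt_v|lt_v]; first by rewrite bin_small.
  by rewrite leqNgt lt_v muln0.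
rewrite (@sum_ord_support _ (minn (x - k).+1 p.+1)) //; last first.
  by rewrite geq_min -subSn // leq_sub2r.
rewrite -(@sum_ord_support _ _ p.+1) ?geq_minr //.
by apply: eq_bigr => v _; rewrite /H -ltnS ltn_ord.
Qed.

(* The coefficient of 'C(x, t) in x ^_ k * 'C(x + s, j). *)
Definition newton_coef k s t j :=
  t ^_ k * \sum_(p < j.+1 | p <= t) 'C(s, j - p) * 'C(k, t - p).

(** Vandermonde expands C(x + s, j) in the C(x, p), and [ffact_mul_bin] absorbs the factor x ^_ k
    into each. *)
Lemma ffact_mul_bin_newton x k s j M : x < M ->
  x ^_ k * 'C(x + s, j) = \sum_(t < M) 'C(x, t) * newton_coef k s t j.
Proof.
move=> lt_xM; rewrite -binomial.Vandermonde big_distrr /=.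
under eq_bigr => p _ do
  rewrite mulnA -(ffact_mul_bin k p lt_xM) big_distrl /= big_mkcond /=.
rewrite exchange_big; apply: eq_bigr => t _ /=.
rewrite /newton_coef mulnA big_distrr /= [RHS]big_mkcond /=.
apply: eq_bigr => p _; case: ifP => // _.
by rewrite -mulnA; congr (_ * _); apply: mulnC.
Qed.

(** For k <= j the sum is Vandermonde's convolution after C(k, p) = C(k, k - p); for j < k both
    sides vanish with j ^_ k. *)
Lemma newton_coef_diag k s j : newton_coef k s j j = j ^_ k * 'C(k + s, k).
Proof.
have [lt_jk|le_kj] := ltnP j k; first by rewrite /newton_coef ffact_small.
congr (_ * _); rewrite -binomial.Vandermonde.
rewrite (reindex_inj rev_ord_inj) /=.
transitivity (\sum_(p < j.+1) 'C(s, p) * 'C(k, p)).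
  by apply: eq_big => p; rewrite subSS ?leq_subr // => _;
    rewrite subKn // -ltnS.
rewrite (@sum_ord_support (fun p => 'C(s, p) * 'C(k, p)) k.+1) ?ltnS //;
  last first.
  by move=> p lt_p; rewrite (@bin_small k) ?muln0.
rewrite [RHS](reindex_inj rev_ord_inj) /=; apply: eq_bigr => p _.
have le_pk : p <= k by rewrite -ltnS.
by rewrite subSS bin_sub // subKn // mulnC.
Qed.

Lemma sum_ffact n k : \sum_(j < n) j ^_ k = k`! * 'C(n, k.+1).
Proof.
elim: n => [|n IHn]; first by rewrite big_ord0 bin0n muln0.
by rewrite big_ord_recr IHn /= binS mulnDr -bin_ffact; congr (_ + _);
  apply: mulnC.
Qed.

End Newton.

(** * The operator U on determinants and moments *)

Section DiscreteMoments.
Variables (R : numDomainType) (m : nat).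
Local Notation N := m.+1.
Implicit Type L : 'I_N -> nat.
Local Notation D := (@binom_det R m).

(** The cofactors of row i do not see the replaced row, so expanding along it makes the sum the
    trace of A X adj(A), which is the trace of adj(A) A X. *)
Lemma sum_det_replace_row n (A C X : 'M[R]_n) (c : 'I_n -> R) :
  (forall i j, c i * C i j = (A *m X) i j) ->
  \sum_i c i * \det (\matrix_(p, j) if p == i then C p j else A p j) =
  \det A * \tr X.
Proof.
move=> cC; transitivity (\tr (A *m X *m \adj A)).
  apply: eq_bigr => i _; rewrite (expand_det_row _ i) mxE big_distrr /=.
  apply: eq_bigr => j _; rewrite !mxE eqxx mulrA cC mxE; congr (_ * _).
  rewrite /cofactor; congr (_ * _); congr determinant; apply/matrixP => p q.
  by rewrite !mxE eq_sym (negPf (neq_lift _ _)).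
by rewrite mxtrace_mulC mulmxA mul_adj_mx mul_scalar_mx mxtraceZ.
Qed.

Lemma sum_binom_det_replace_row L (f : 'I_N -> nat) (X : 'M[R]_N) (c : 'I_N ->
  R) :
  (forall i j : 'I_N, c i * 'C(f i, m - j)%:R =
                      \sum_(t < N) 'C(L i, m - t)%:R * X t j) ->
  \sum_i c i * D (fun p => if p == i then f p else L p) = D L * \tr X.
Proof.
move=> cf; rewrite -(@sum_det_replace_row _ _
    (\matrix_(i, j) 'C(f i, m - j)%:R) _ c) => [|i j].
  apply: eq_bigr => i _; congr (_ * _); congr determinant; apply/matrixP => p j.
  by rewrite !mxE; case: ifP.
by rewrite !mxE cf; apply: eq_bigr => t _; rewrite mxE.
Qed.

(** Pascal's rule expresses the row of L_i + 1 through the row of L_i: [X] is the identity plus a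
    subdiagonal, so its trace is N. *)
Lemma up_binom_det : @up R N D =1 fun L => N%:R * D L.
Proof.
move=> L; pose X : 'M[R]_N := \matrix_(t, j) ((t == j)%:R + (t == j.+1 :>
  nat)%:R).
transitivity (D L * \tr X); last first.
  rewrite mulrC; congr (_ * _);
    rewrite /mxtrace -[in RHS](card_ord N) -sum1_card.
  rewrite natr_sum; apply: eq_bigr => i _.
  by rewrite mxE eqxx ltn_eqF // addr0.
rewrite -(@sum_binom_det_replace_row _ (fun i => (L i).+1) _ (fun=> 1)) => [|i
  j].
  apply: eq_bigr => i _; rewrite mul1r; congr D; apply/funext => p.
  by rewrite /add_at; case: eqP; rewrite ?addn1 ?addn0.
rewrite mul1r; under eq_bigr do rewrite mxE mulrDr.
rewrite big_split /= (bigD1 j) //= eqxx mulr1 [X in _ = _ + X + _]big1;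
  last first.
  by move=> t /negPf->; rewrite mulr0.
rewrite addr0; have [lt_jm|le_mj] := ltnP j m.
  rewrite (bigD1 (inord j.+1)) //= inordK // eqxx mulr1 big1 ?addr0.
    by rewrite -natrD -(subnSK lt_jm) binS.
  move=> t; rewrite -val_eqE /= inordK // => /negPf->.
  by rewrite mulr0.
have ej : (m - j = 0)%N by apply/eqP; rewrite subn_eq0.
rewrite ej !bin0 big1 ?addr0 // => t _.
by rewrite ltn_eqF ?mulr0 // ltnS (leq_trans (leq_ord t)).
Qed.

Lemma alternating_binom_det : alternating D.
Proof.
move=> s L; rewrite -det_perm -det_mulmx; congr determinant.
by rewrite -row_permE; apply/matrixP => i j; rewrite !mxE.
Qed.

Definition moment k s L : R :=
  \sum_i (L i ^_ k)%:R * D (fun j => L j + s * (j == i))%N.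

Lemma moment0 k L : moment k 0 L = (\sum_i (L i ^_ k)%:R) * D L.
Proof.
rewrite /moment mulr_suml; apply: eq_bigr => i _; congr (_ * D _).
by apply/funext => j; rewrite mul0n addn0.
Qed.

Lemma alternating_moment0 k : alternating (moment k 0).
Proof.
move=> s L; rewrite !moment0 alternating_binom_det mulrCA; congr (_ * (_ * _)).
by rewrite [RHS](reindex_inj (@perm_inj _ s)).
Qed.

Lemma ffactSD n k : (n.+1 ^_ k = n ^_ k + k * n ^_ k.-1)%N.
Proof.
case: k => [|k]; first by rewrite !ffactn0.
rewrite ffactSS ffactnSr /= [(n ^_ k * _)%N]mulnC -mulnDl.
have [lt_nk|le_kn] := ltnP n k; first by rewrite ffact_small ?muln0.
by rewrite addnS subnK.
Qed.

(** Only the step at p = i changes the factor L_i ^_ k, by k L_i ^_ (k - 1); the rest is U acting on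
    D alone. At k = 0 the value of [k.-1] is harmless, as its coefficient is 0. *)
Lemma up_moment k s L :
  up (moment k s) L = N%:R * moment k s L + k%:R * moment k.-1 s.+1 L.
Proof.
rewrite /up /moment exchange_big /= !big_distrr -big_split /=.
apply: eq_bigr => i _.
pose L' j := (L j + s * (j == i))%N.
have addL p : (fun j => add_at L p j + s * (j == i))%N = add_at L' p.
  by apply/funext => j; rewrite /add_at /L' addnAC.
under eq_bigr do rewrite addL.
have := up_binom_det L'; rewrite /up => upL'.
rewrite mulrCA -upL' (bigD1 i) //= [in RHS](bigD1 i) //= mulrDr -addrA.
rewrite [X in _ = _ + X]addrC addrA.
have -> : (fun j => L j + s.+1 * (j == i))%N = add_at L' i.
  by apply/funext => j; rewrite /add_at /L' mulSnr addnA.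
rewrite [in LHS]/add_at eqxx addn1 mulrA -mulrDl -natrM -natrD -ffactSD.
congr (_ + _); rewrite big_distrr; apply: eq_bigr => p /negPf ne_pi /=.
by rewrite /add_at eq_sym ne_pi addn0.
Qed.

(** By [up_moment] each step either multiplies by N or shifts (k, s) to (k - 1, s + 1) with factor
    k. The r shifts can be placed in C(n, r) ways, and their factors multiply to k ^_ r. *)
Lemma iter_up_moment n k L :
  iter n (@up R N) (moment k 0) L =
  \sum_(r < k.+1) ('C(n, r) * N ^ (n - r) * k ^_ r)%:R * moment (k - r) r L.
Proof.
elim: n L => [|n IHn] L.
  rewrite big_ord_recl /= bin0 ffactn0 !subn0 mul1r big1 ?addr0 // => i _.
  by rewrite bin0n mul0r.
pose E n r := ('C(n, r) * N ^ (n - r))%N.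
pose f r := (N * E n r * k ^_ r)%:R * moment (k - r) r L.
pose h r := (E n r * k ^_ r.+1)%:R * moment (k - r.+1) r.+1 L.
transitivity (\sum_(r < k.+1) f r + \sum_(r < k.+1) h r).
  rewrite iterS (_ : iter n _ _ = fun L =>
    \sum_(r < k.+1) (E n r * k ^_ r)%:R * moment (k - r) r L);
      last exact/funext.
  rewrite /up exchange_big -big_split /=; apply: eq_bigr => r _.
  rewrite -mulr_sumr -/(up _ _) up_moment /f /h mulrDr subnS; congr (_ + _).
    by rewrite mulrA [_ * N%:R]mulrC -natrM mulnA.
  by rewrite mulrA -natrM -mulnA -ffactnSr.
(* A shift number k + 1 is excluded by k ^_ (k + 1) = 0; the other terms combine by Pascal's rule in
   n. *)
rewrite [X in _ + X]big_ord_recr /= {2}/h ffact_small // muln0 mul0r addr0.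
rewrite big_ord_recl [RHS]big_ord_recl -addrA -big_split /=; congr (_ + _).
  by rewrite /f /E !bin0 !subn0 !mul1n expnS.
apply: eq_bigr => r _; rewrite /f /h /bump /= -mulrDl -natrD -mulnDl;
  congr ((_ * _)%:R * _).
rewrite /E binS mulnDl subSS; congr (_ + _)%N.
have [lt_rn|le_nr] := ltnP r n; last by rewrite bin_small ?muln0.
by rewrite mulnCA -expnS subnSK.
Qed.

(** On the staircase the matrix of D is unitriangular, so D is 1 and only the trace of the Newton
    coefficients is left: C(k + s, k) times the sum of j ^_ k over j < N. *)
Lemma moment_staircase k s :
  moment k s (fun i => m - i)%N = ('C(k + s, k) * (k`! * 'C(N, k.+1)))%:R.
Proof.
pose X : 'M[R]_N := \matrix_(t, j) (newton_coef k s (m - t) (m - j))%:R.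
transitivity (D (fun i => m - i)%N * \tr X).
  rewrite -(@sum_binom_det_replace_row _ (fun i => m - i + s)%N _
    (fun i => ((m - i) ^_ k)%:R)) => [|i j].
    apply: eq_bigr => i _; congr (_ * D _); apply/funext => p.
    by case: eqP => [->|]; rewrite ?muln1 ?muln0 ?addn0.
  rewrite -natrM (@ffact_mul_bin_newton _ _ _ _ N) ?ltnS ?leq_subr // natr_sum.
  rewrite (reindex_inj rev_ord_inj) /=; apply: eq_bigr => t _.
  by rewrite mxE subSS natrM.
have -> : D (fun i => m - i)%N = 1.
  apply: det_upper_unitriangular => [i j lt_ji|i];
    rewrite mxE ?binn // bin_small //.
  by rewrite ltn_sub2l // (leq_trans lt_ji) ?leq_ord.
rewrite mul1r /mxtrace; under eq_bigr do rewrite mxE newton_coef_diag.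
rewrite -natr_sum -big_distrl /= (reindex_inj rev_ord_inj) /= mulnC.
congr (_ * _)%:R; rewrite -sum_ffact; apply: eq_bigr => i _.
by rewrite subSS subKn // leq_ord.
Qed.

End DiscreteMoments.

(** * Summation over partitions *)

Section Partitions.
Local Open Scope nat_scope.

Section SeqPartitions.
Implicit Type s : seq nat.

(** In a nonincreasing sequence the zeros come last, where the default value 0 replaces them. *)
Lemma nth_filter_nonzero s i :
  sorted geq s -> nth 0 [seq x <- s | x != 0] i = nth 0 s i.
Proof.
elim: s i => [|x s IHs] i // ps; have /IHs{}IHs := path_sorted ps.
rewrite /=; have [x0|x0] := eqVneq x 0; last by case: i.
rewrite IHs; suff s0 j : nth 0 s j = 0 by case: i => [|i]; rewrite /= !s0 ?x0.
have [lt_j|le_j] := ltnP j (size s); last by rewrite nth_default.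
have /order_path_min/allP := ps => /(_ (rev_trans leq_trans))/(_ _ (mem_nth 0
  lt_j)).
by rewrite x0 /= leqn0 => /eqP.
Qed.

Lemma sumn_filter_nonzero s : sumn [seq x <- s | x != 0] = sumn s.
Proof. by elim: s => //= x s IHs; have [->|_] := eqVneq x 0;
  rewrite /= IHs. Qed.

Lemma nth_ltn_size_nonzero s i : 0 \notin s -> (0 < nth 0 s i) = (i < size s).
Proof.
move=> s0; apply/idP/idP => [|lt_i]; first exact: nth_ltn_size.
by rewrite lt0n; apply: contraNneq s0 => <-; apply: mem_nth.
Qed.

Lemma eq_from_nth_nonzero s t : 0 \notin s -> 0 \notin t ->
  (forall i, nth 0 s i = nth 0 t i) -> s = t.
Proof.
move=> s0 t0 e; apply: (@eq_from_nth _ 0) => // .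
apply/eqP; rewrite eqn_leq; apply/andP; split; rewrite leqNgt; apply/negP.
  by rewrite -nth_ltn_size_nonzero // e nth_ltn_size_nonzero // ltnn.
by rewrite -nth_ltn_size_nonzero // -e nth_ltn_size_nonzero // ltnn.
Qed.

Lemma leq_nth_sumn s i : nth 0 s i <= sumn s.
Proof.
elim: s i => [|x s IHs] [|i] //=; first exact: leq_addr.
by rewrite (leq_trans (IHs i)) ?leq_addl.
Qed.

End SeqPartitions.

Section PartitionOfShape.
Variables N B : nat.
Local Notation shape := {ffun 'I_N -> 'I_B}.

Definition partition_of (f : shape) := [seq x <- parts f | x != 0].

Lemma sorted_parts (f : shape) : nonincr f -> sorted geq (parts f).
Proof. by move=> df; apply/(sortedP 0) => i _; apply: (nonincrP _ df). Qed.

Lemma nth_partition_of (f : shape) i : nonincr f ->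
  nth 0 (partition_of f) i = nth 0 (parts f) i.
Proof. by move=> df; apply/nth_filter_nonzero/sorted_parts. Qed.

Lemma is_intpart_partition_of (f : shape) : nonincr f ->
  is_intpart (partition_of f).
Proof.
move=> df; rewrite /is_intpart mem_filter eqxx andbT.
by rewrite sorted_filter ?sorted_parts // => x y z /[swap]; apply: leq_trans.
Qed.

Lemma partition_of_inj (f h : shape) : nonincr f -> nonincr h ->
  partition_of f = partition_of h -> f = h.
Proof.
move=> df dh e; apply/ffunP => i; apply: val_inj => /=.
by rewrite -!nth_parts -!nth_partition_of // e.
Qed.

Lemma partition_of_surj l : is_intpart l -> size l <= N -> sumn l < B ->
  exists2 f : shape, nonincr f & partition_of f = l.
Proof.
move=> /andP[sl l0] le_lN lt_lB.
pose f : shape := [ffun i : 'I_N => Ordinal (leq_ltn_trans (leq_nth_sumn l i)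
  lt_lB)].
have nth_f i : nth 0 (parts f) i = nth 0 l i.
  have [lt_i|le_i] := ltnP i N;
    first by rewrite (nth_parts f (Ordinal lt_i)) ffunE.
  by rewrite nth_parts_out // nth_default // (leq_trans le_lN).
have df : nonincr f.
  apply/nonincrP => i; rewrite !nth_f.
  have [lt_i|le_i] := ltnP i.+1 (size l); first exact: (sortedP 0 sl).
  by rewrite nth_default.
exists f => //; apply: eq_from_nth_nonzero => // [|i];
  first by rewrite mem_filter eqxx.
by rewrite nth_partition_of.
Qed.

End PartitionOfShape.

End Partitions.

(** * Pochhammer symbols, series, and sums over partitions of a fixed size *)

Lemma pochhammerN (R : realType) k i :
  pochhammer (- k%:R : R) i = (-1) ^+ i * (k ^_ i)%:R.
Proof.
elim: i => [|i IHi]; first by rewrite /pochhammer big_ord0 mul1r.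
rewrite /pochhammer big_ord_recr /= -/(pochhammer _ i) IHi ffactnSr natrM.
have [le_ik|lt_ki] := leqP i k; last by rewrite ffact_small // !(mul0r, mulr0).
by rewrite natrB // exprS; ring.
Qed.

Lemma pochhammer2 (R : realType) i : pochhammer (2 : R) i = (i.+1)`!%:R.
Proof.
elim: i => [|i IHi]; first by rewrite /pochhammer big_ord0.
rewrite /pochhammer big_ord_recr /= -/(pochhammer _ i) IHi [in RHS]factS natrM.
by rewrite mulrC -natrD.
Qed.

Lemma lim_series_finite_support (R : realType) (u : nat -> R) K :
  (forall i, (K <= i)%N -> u i = 0) -> limn (series u) = \sum_(i < K) u i.
Proof.
move=> u0; apply/cvg_lim => //; apply: cvg_near_cst; near=> n.
have le_Kn : (K <= n)%N by near: n; apply: nbhs_infty_ge.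
rewrite /series /= (big_cat_nat (n := K)) //= big_mkord [X in _ +
  X]big_nat_cond.
rewrite [X in _ + X]big1 ?addr0 // => i /andP[/andP[le_Ki _] _]; exact: u0.
Unshelve. all: by end_near. Qed.

(** As C(n, r) / n! = 1 / (r! (n - r)!), dropping the r vanishing first terms leaves a multiple of
    the exponential series of y x. *)
Lemma cvg_series_binom_exp (R : realType) (x y : R) r :
  series (fun n => x ^+ n / n`!%:R * ('C(n, r)%:R * y ^+ (n - r))) @ \oo -->
  (x ^+ r / r`!%:R * expR (y * x)).
Proof.
set u := (X in series X); rewrite -(cvg_shiftn r).
rewrite (_ : [sequence _]_n = fun n => x ^+ r / r`!%:R * series (exp_coeff (y *
  x)) n).
  by apply: cvgMr; apply: is_cvg_series_exp_coeff.
apply/funext => n; rewrite /= /series /= (big_cat_nat (n := r)) ?leq_addl //=.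
rewrite big_nat_cond big1 ?add0r => [|i /andP[/andP[_ lt_i] _]]; last first.
  by rewrite /u bin_small // mul0r mulr0.
rewrite -{1}[r]add0n big_addn addnK big_distrr; apply: eq_bigr => i _ /=.
rewrite /u /exp_coeff /= addnK exprMn exprD.
have /(congr1 (fun z => z%:R : R)) := bin_fact (leq_addl i r).
rewrite addnK !natrM => <-.
have r0 : r`!%:R != 0 :> R by rewrite pnatr_eq0 -lt0n fact_gt0.
have i0 : i`!%:R != 0 :> R by rewrite pnatr_eq0 -lt0n fact_gt0.
have b0 : 'C(i + r, r)%:R != 0 :> R by rewrite pnatr_eq0 -lt0n bin_gt0 leq_addl.
by field; rewrite r0 i0 b0.
Qed.

(** Partitions with more than N parts contribute 0, and the parts of a partition of n are at most n,
    so functions into ['I_n.+1] account for the whole sum. *)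
Lemma esum_intpart_sumn (R : realType) N n (a : seq nat -> R) :
  (forall l, 0 <= a l) ->
  (forall l, is_intpart l -> (N < size l)%N -> a l = 0) ->
  \esum_(l in [set l | is_intpart l /\ sumn l = n]) (a l)%:E =
  (\sum_(f : {ffun 'I_N -> 'I_n.+1} | nonincr f && (sumn (parts f) == n))
     a (partition_of f))%:E.
Proof.
move=> a_ge0 a_tall; pose short := [set l : seq nat | (size l <= N)%N].
rewrite (esumID short) => [|l _]; last by rewrite lee_fin.
rewrite [X in (_ + X)%E]esum1 ?adde0 => [|l [[il _] /negP]]; last first.
  by rewrite -ltnNge => lt_N; rewrite a_tall.
pose P : set {ffun 'I_N -> 'I_n.+1} := [set f | nonincr f && (sumn (parts f) ==
  n)].
rewrite (@reindex_esum _ _ _ P _ (@partition_of N n.+1)); last first.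
  split=> [f /= /andP[df /eqP sf]|f h|l [[il sl] le_l]].
  - split; first by rewrite /= sumn_filter_nonzero is_intpart_partition_of.
    rewrite /short /= size_filter (leq_trans (count_size _ _)) //.
    by rewrite size_parts.
  - by rewrite !inE => /andP[df _] /andP[dh _]; apply: partition_of_inj.
  - have [|f df fl] := @partition_of_surj N n.+1 l il le_l; first by rewrite sl.
    by exists f => //; rewrite /P /= df -sumn_filter_nonzero -/(partition_of f)
      fl sl eqxx.
rewrite esum_fset; [|exact: finite_finset|by move=> f _; rewrite lee_fin].
rewrite (@fsbigE _ _ _ _ _ (enum [pred f | nonincr f && (sumn (parts f) ==
  n)])).
- rewrite big_enum_cond -sumEFin; apply: eq_bigl => f.
  by rewrite inE; apply/andP/idP => [[]//|Pf]; split=> //; apply: mem_set.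
- exact: enum_uniq.
- by move=> f; rewrite /= mem_enum.
- by move=> f Pf; rewrite mem_enum inE; move: Pf; rewrite /P /= => ->.
Qed.

(** * Poissonization and the hypergeometric series *)

Section Poissonization.
Variables (R : realType) (theta : R) (m k : nat).
Hypothesis theta_gt0 : 0 < theta.
Local Notation N := m.+1.

Let term (l : seq nat) : R :=
  F_moment R N k l * expR (- (N%:R * theta)) *
  (theta ^+ sumn l / (sumn l)`!%:R) * schur1 R N l * (num_syt l)%:R.

(** The factor k ^_ r of [iter_up_moment] times the staircase value of M_(k-r,r), by k ^_ r (k - r)!
    = k!. *)
Let coef r : nat := (k`! * 'C(k, r) * 'C(N, (k - r).+1))%N.

Lemma term_ge0 l : 0 <= term l.
Proof.
rewrite /term schur1E; do !apply: mulr_ge0;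
  rewrite ?invr_ge0 ?ler0n ?expR_ge0 //.
- by apply: sumr_ge0 => i _; rewrite ler0n.
- by rewrite exprn_ge0 // ltW.
Qed.

Lemma term_partition_of B (f : {ffun 'I_N -> 'I_B}) : nonincr f ->
  let n := sumn (parts f) in
  term (partition_of f) = expR (- (N%:R * theta)) / N%:R *
    (theta ^+ n / n`!%:R *
     ((tab_count (leq^~ 1%N) (parts f) n)%:R * moment R k 0 (shifted f))).
Proof.
move=> df n; have e_nth i := nth_partition_of i df.
rewrite /term sumn_filter_nonzero -/n schur1E (eq_tab_count _ _ (fun i => esym
  (e_nth i))).
rewrite num_sytE sumn_filter_nonzero (eq_tab_count _ _ (fun i => esym (e_nth
  i))) -/n.
rewrite (tab_count_semistandard R df) moment0.
have -> : F_moment R N k (partition_of f) =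
    N%:R^-1 * \sum_i (shifted f i ^_ k)%:R.
  by congr (_ * _); apply: eq_bigr => i _; rewrite e_nth nth_parts subSS.
by ring.
Qed.

Lemma esum_term_sumn n :
  \esum_(l in [set l | is_intpart l /\ sumn l = n]) (term l)%:E =
  (\sum_(r < k.+1) expR (- (N%:R * theta)) / N%:R * (coef r)%:R *
     (theta ^+ n / n`!%:R * ('C(n, r)%:R * N%:R ^+ (n - r))))%:E.
Proof.
rewrite (@esum_intpart_sumn _ N) => [|l|l /andP[_ l0] lt_N]; last 2 first.
- exact: term_ge0.
- by rewrite /term schur1E tab_count_tall // mulr0 mul0r.
congr (_%:E); set c := expR _ / _.
under eq_bigr => f /andP[df /eqP sf] do rewrite term_partition_of // sf.
rewrite -!mulr_sumr (sum_syt_iter_up (alternating_moment0 R k) (ltnSn n)).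
rewrite iter_up_moment !mulr_sumr; apply: eq_bigr => r _.
have le_rk : (r <= k)%N by rewrite -ltnS.
rewrite moment_staircase subnK // bin_sub // /coef.
rewrite -[in RHS](ffact_fact le_rk) !natrM natrX.
by rewrite /c; ring.
Qed.

(** The terms are nonnegative, so the sum may be grouped by size. For each r the series in n gives
    theta^r / r! times e^(N theta), which the prefactor cancels. *)
Lemma esum_term :
  \esum_(l in [set l | is_intpart l]) (term l)%:E =
  (\sum_(r < k.+1) (coef r)%:R / N%:R * (theta ^+ r / r`!%:R))%:E.
Proof.
have -> : [set l | is_intpart l] =
    \bigcup_(n in [set: nat]) [set l | is_intpart l /\ sumn l = n].
  by apply/seteqP; split=> [l il|l [n _ []]//]; exists (sumn l).
rewrite esum_bigcupT; first last.
- by move=> l; rewrite lee_fin term_ge0.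
- by move=> i j _ _ [l [[_ <-] [_ <-]]].
have sum_ge0 n : (0 <= \esum_(l in [set l | is_intpart l /\ sumn l = n]) (term
  l)%:E)%E.
  by apply: esum_ge0 => l _; rewrite lee_fin term_ge0.
rewrite -nneseries_esumT //; apply/cvg_lim => //.
pose v r (n : nat) : R := theta ^+ n / n`!%:R * ('C(n, r)%:R * N%:R ^+ (n - r)).
pose c (r : nat) : R := expR (- (N%:R * theta)) / N%:R * (coef r)%:R.
rewrite [X in X @ \oo --> _](_ : _ =
    fun n => (\sum_(r < k.+1) c r * series (v r) n)%:E); last first.
  apply/funext => n; under eq_bigr do rewrite esum_term_sumn.
  rewrite sumEFin exchange_big /=; congr (_%:E).
  by apply: eq_bigr => r _; rewrite -mulr_sumr.
apply: cvg_EFin; first exact: nearW.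
apply: cvg_big; first exact: add_continuous.
move=> r _; rewrite /c.
have -> : (coef r)%:R / N%:R * (theta ^+ r / r`!%:R) =
   expR (- (N%:R * theta)) / N%:R * (coef r)%:R *
   (theta ^+ r / r`!%:R * expR (N%:R * theta)).
  rewrite expRN; have e0 : expR (N%:R * theta) != 0 by rewrite expR_eq0.
  have f0 : r`!%:R != 0 :> R by rewrite pnatr_eq0 -lt0n fact_gt0.
  have n0 : N%:R != 0 :> R by rewrite pnatr_eq0.
  by move: (N%:R : R) n0 e0 => x n0 e0; field; rewrite f0 n0 e0.
apply: cvgMr; exact: cvg_series_binom_exp.
Qed.

(** The symbol (-k)_i vanishes for i > k, and r = k - i matches the terms. The signs (-1)^i of the
    three upper Pochhammer symbols and of the argument cancel. *)
Lemma hypergeom31_sum :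
  theta ^+ k * hypergeom31 (- k%:R) (- k%:R) (1 - N%:R) 2 (- (1 / theta)) =
  \sum_(r < k.+1) (coef r)%:R / N%:R * (theta ^+ r / r`!%:R).
Proof.
have -> : 1 - N%:R = - m%:R :> R by rewrite -natr1; ring.
rewrite /hypergeom31 (@lim_series_finite_support _ _ k.+1) => [|i lt_ki];
  last first.
  by rewrite pochhammerN ffact_small // !(mulr0, mul0r).
rewrite mulr_sumr [RHS](reindex_inj rev_ord_inj) /=; apply: eq_bigr => i _.
have le_ik : (i <= k)%N by rewrite -ltnS.
rewrite subSS /coef subKn // bin_sub // 2!natrM !pochhammerN pochhammer2.
have fact0 j : j`!%:R != 0 :> R by rewrite pnatr_eq0 -lt0n fact_gt0.
have N0 : N%:R != 0 :> R by rewrite pnatr_eq0.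
have th0 : theta ^+ i != 0 by rewrite expf_neq0 // gt_eqF.
(* From N m ^_ i = N ^_ (i + 1), with N = m + 1. *)
have -> : (m ^_ i)%:R = 'C(N, i.+1)%:R * i.+1`!%:R / N%:R :> R.
  by apply: (canRL (mulfK N0)); rewrite -!natrM bin_ffact ffactSS mulnC.
have -> : 'C(k, i)%:R = (k ^_ i)%:R / i`!%:R :> R.
  by apply: (canRL (mulfK (fact0 i))); rewrite -natrM bin_ffact.
rewrite -(ffact_fact le_ik) natrM.
have -> : theta ^+ k = theta ^+ (k - i) * theta ^+ i by rewrite -exprD subnK.
rewrite -[- (1 / theta)]mulN1r exprMn div1r exprVn -(signr_odd _ i).
move: (N%:R : R) (i.+1`!%:R : R) (i`!%:R : R) ((k - i)`!%:R : R) (theta ^+ i :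
  R)
  N0 (fact0 i.+1) (fact0 i) (fact0 (k - i)%N) th0 => n f1 f2 f3 t n0 f10 f20
    f30 t0.
by case: (odd i); rewrite ?expr1 ?expr0; field; rewrite n0 f10 f20 f30 t0.
Qed.

End Poissonization.

Theorem corollary1 (R : realType) (theta : R) (N k : nat)
    (theta_gt0 : 0 < theta) (N_ge1 : (1 <= N)%N) :
  \esum_(l in [set l : seq nat | is_intpart l])
    (F_moment R N k l * expR (- (N%:R * theta)) *
     (theta ^+ sumn l / (sumn l)`!%:R) * schur1 R N l * (num_syt l)%:R)%:E
  = (theta ^+ k *
     hypergeom31 (- k%:R) (- k%:R) (1 - N%:R) 2 (- (1 / theta)))%:E.
Proof.
case: N N_ge1 => // m _; rewrite hypergeom31_sum //; exact: esum_term.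
Qed.
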